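(* Let $(S,\Sigma)$ be a measurable space, let $\mathrm{M}$ be the set of all nonnegative real-valued (hence finite) measures on $\Sigma$, and let $\Lambda$ be any subset of $\mathrm{M}$. Let $k\ge1$ be an integer, let $f_1,\dots,f_k\colon S\to\mathbb{R}$ be $\Sigma$-measurable functions, $\mathbf{f}=(f_1,\dots,f_k)$, and let $c\in\mathbb{R}^k$. Let $\Lambda_{\mathbf{f},c}=\{\mu\in\Lambda\colon \mathbf{f}\in L^1(\mu),\ \int_S\mathbf{f}\,d\mu=c\}$. Take any $\mu\in\Lambda_{\mathbf{f},c}$ such that for some integer $m$ with $1\le m\le k$ there is an atomic non-null $(m,\mu)$-partition $(A_1,\dots,A_m)$ of $S$ for which the vectors $\int_{A_1}\mathbf{f}\,d\mu,\dots,\int_{A_m}\mathbf{f}\,d\mu$ are linearly independent. Then $\mu\in\operatorname{ex}\Lambda_{\mathbf{f},c}$.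
   Context: For $\mu\in\mathrm{M}$ and $A\in\Sigma$, the truncation $\mu_A\in\mathrm{M}$ is defined by $\mu_A(B)=\mu(A\cap B)$ for $B\in\Sigma$. A set $A\in\Sigma$ is a $\mu$-atom if $\mu_A(B)\in\{0,\mu(A)\}$ for all $B\in\Sigma$. An $n$-tuple $(A_1,\dots,A_n)$ of members of $\Sigma$ is a non-null $(n,\mu)$-partition of $S$ if the $A_i$ are pairwise disjoint, $A_1\cup\dots\cup A_n=S$, and $\mu(A_i)>0$ for all $i$; it is atomic if each $A_i$ is a $\mu$-atom. One writes $\mathbf{f}\in L^1(\mu)$ if every $f_j$ is $\mu$-integrable, and $\int_A\mathbf{f}\,d\mu=(\int_A f_1\,d\mu,\dots,\int_A f_k\,d\mu)$. For a (not necessarily convex) set $\mathrm{K}\subseteq\mathrm{M}$, $\operatorname{ex}\mathrm{K}$ is the set of all extreme points of $\mathrm{K}$: $\mu\in\operatorname{ex}\mathrm{K}$ iff $\mu\in\mathrm{K}$ and for any $t\in(0,1)$ and $\nu_0,\nu_1\in\mathrm{K}$ with $(1-t)\nu_0+t\nu_1=\mu$ one has $\nu_0=\nu_1$. *)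

(* Defs.v *)
From HB Require Import structures.
From mathcomp Require Import all_boot all_order all_algebra.
From mathcomp Require Import all_classical all_reals all_analysis.

Set Implicit Arguments.
Unset Strict Implicit.
Unset Printing Implicit Defensive.

Import Order.TTheory GRing.Theory Num.Theory.
Import numFieldNormedType.Exports.

Local Open Scope classical_set_scope.
Local Open Scope ring_scope.

(* The carrier of a [measurableType] is pointed.  This excludes only the empty
   space, on which no set has positive measure. *)

(* A library measure is a function on all of [set S], constrained only on the
   measurable sets.  Measures on the sigma-algebra are therefore identified
   when they agree on the measurable sets. *)
Definition meas_eq (d : measure_display) (S : measurableType d) (R : realType)
    (mu nu : {finite_measure set S -> \bar R}) : Prop :=
  forall B, measurable B -> mu B = nu B.

Definition is_convex_comb (d : measure_display) (S : measurableType d)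
    (R : realType) (t : R) (nu0 nu1 mu : {finite_measure set S -> \bar R}) :
    Prop :=
  forall B, measurable B ->
    ((1 - t)%:E * nu0 B + t%:E * nu1 B)%E = mu B.

(* No convexity of [K] is assumed. *)
Definition ex (d : measure_display) (S : measurableType d) (R : realType)
    (K : set {finite_measure set S -> \bar R}) :
    set {finite_measure set S -> \bar R} :=
  [set mu | K mu /\
    forall (t : R) (nu0 nu1 : {finite_measure set S -> \bar R}),
      0 < t < 1 -> K nu0 -> K nu1 -> is_convex_comb t nu0 nu1 mu ->
      meas_eq nu0 nu1].

(* [mrestr mu mA] is the truncation [fun B => mu (B `&` A)].  Null measurable
   sets are atoms under this definition. *)
Definition is_atom (d : measure_display) (S : measurableType d) (R : realType)
    (mu : {finite_measure set S -> \bar R}) (A : set S) : Prop :=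
  exists mA : measurable A, forall B, measurable B ->
    mrestr mu mA B = 0%E \/ mrestr mu mA B = mu A.

Definition nonnull_partition (d : measure_display) (S : measurableType d)
    (R : realType) (n : nat) (mu : {finite_measure set S -> \bar R})
    (A : 'I_n -> set S) : Prop :=
  [/\ forall i, measurable (A i),
      trivIset [set: 'I_n] A,
      \bigcup_i A i = [set: S] &
      forall i, (0 < mu (A i))%E].

Definition atomic_nonnull_partition (d : measure_display)
    (S : measurableType d) (R : realType) (n : nat)
    (mu : {finite_measure set S -> \bar R}) (A : 'I_n -> set S) : Prop :=
  nonnull_partition mu A /\ forall i, is_atom mu (A i).

Definition in_L1 (d : measure_display) (S : measurableType d) (R : realType)
    (k : nat) (mu : {finite_measure set S -> \bar R}) (f : 'I_k -> S -> R) :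
    Prop :=
  forall j, mu.-integrable [set: S] (EFin \o f j).

(* [Rintegral] is 0 when the integral is infinite; the intended use is under
   [in_L1 mu f]. *)
Definition vec_integral (d : measure_display) (S : measurableType d)
    (R : realType) (k : nat) (mu : {finite_measure set S -> \bar R})
    (A : set S) (f : 'I_k -> S -> R) : 'rV[R]_k :=
  \row_(j < k) \int[mu]_(x in A) f j x.

Definition moment_set (d : measure_display) (S : measurableType d)
    (R : realType) (k : nat) (Lambda : set {finite_measure set S -> \bar R})
    (f : 'I_k -> S -> R) (c : 'rV[R]_k) :
    set {finite_measure set S -> \bar R} :=
  [set mu | [/\ Lambda mu, in_L1 mu f & vec_integral mu [set: S] f = c]].

(* Main.v *)
(* If [mu] is a proper convex combination of [nu0] and [nu1], then both are
   absolutely continuous with respect to [mu], hence proportional to [mu] on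
   each atom [A i].  The moment condition gives the same combination [c] of the
   linearly independent vectors [vec_integral mu (A i) f] for both families of
   ratios, so the ratios coincide, and with them [nu0] and [nu1]. *)
Require Import Defs.
From HB Require Import structures.
From mathcomp Require Import all_boot all_order all_algebra.
From mathcomp Require Import all_classical all_reals all_analysis.

Set Implicit Arguments.
Unset Strict Implicit.
Unset Printing Implicit Defensive.

Import Order.TTheory GRing.Theory Num.Theory.
Import numFieldNormedType.Exports.

Local Open Scope classical_set_scope.
Local Open Scope ring_scope.

(* Every measurable part [B] of [A] or its complement in [A] is null, for [mu]
   and hence for [nu], so the ratio [nu A / mu A] works. *)
Lemma atom_proportional (d : measure_display) (S : measurableType d)
    (R : realType) (mu nu : {finite_measure set S -> \bar R}) (A : set S) :
  (forall B, measurable B -> mu B = 0%E -> nu B = 0%E) ->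
  is_atom mu A -> (0 < mu A)%E ->
  exists r : {nonneg R}, forall B, measurable B -> B `<=` A ->
    nu B = (r%:num%:E * mu B)%E.
Proof.
move=> numu [mA atomA] muA_gt0.
have muA_fin : mu A \is a fin_num by exact: fin_num_measure.
have nuA_fin : nu A \is a fin_num by exact: fin_num_measure.
have a_gt0 : 0 < fine (mu A) by rewrite -lte_fin fineK.
have r_ge0 : 0 <= fine (nu A) / fine (mu A) by rewrite divr_ge0// fine_ge0.
exists (NngNum r_ge0) => B mB BA /=.
have [muB|muB] := atomA _ mB; rewrite /mrestr (setIidl BA) in muB.
  by rewrite muB mule0 numu.
(* Here [B] carries all the mass of [A]; finiteness of [mu A] allows the subtraction. *)
have muD : mu (A `\` B) = 0%E.
  rewrite measureD//; last by rewrite ltey_eq muA_fin.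
  by rewrite (setIidr BA) [X in (_ - X)%E]muB subee.
(* The right-hand side collapses to [nu A], which equals [nu B] because [A] minus [B] is also
   [nu]-null. *)
rewrite muB -[in RHS](fineK muA_fin) -EFinM divfK ?gt_eqF// fineK//.
have mD : measurable (A `\` B) by exact: measurableD.
by rewrite -[in RHS](setDUK BA) measureU0//; exact: numu.
Qed.

(** Inside [A] the measure [nu] agrees with [mscale r mu]. Scaling is applied to the positive and
    negative parts separately, and integrability keeps their difference well defined. *)
Lemma Rintegral_proportional (d : measure_display) (S : measurableType d)
    (R : realType) (mu nu : {measure set S -> \bar R}) (A : set S)
    (r : {nonneg R}) (f : S -> R) :
  measurable A -> mu.-integrable A (EFin \o f) ->
  (forall B, measurable B -> B `<=` A -> nu B = (r%:num%:E * mu B)%E) ->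
  \int[nu]_(x in A) f x = r%:num * \int[mu]_(x in A) f x.
Proof.
move=> mA intf nuE; have mf := measurable_int _ intf.
rewrite /Rintegral (eq_measure_integral (mscale r mu))//.
rewrite integralE !ge0_integral_mscale//; last 2 first.
- exact: measurable_realfun.measurable_funeneg.
- exact: measurable_realfun.measurable_funepos.
rewrite -muleBr//; last exact: integrable_add_def.
by rewrite -integralE fineM//; exact: integrable_fin_num.
Qed.

Lemma bigsetU_ord_bigcup (T : Type) (n : nat) (A : 'I_n -> set T) :
  \big[setU/set0]_(i < n) A i = \bigcup_i A i.
Proof. by rewrite -bigcup_pred; apply: eq_bigcupl; split. Qed.

Lemma measure_partition (d : measure_display) (S : measurableType d)
    (R : realType) (mu : {measure set S -> \bar R}) (n : nat)
    (A : 'I_n -> set S) (B : set S) :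
  (forall i, measurable (A i)) -> trivIset [set: 'I_n] A ->
  \bigcup_i A i = [set: S] -> measurable B ->
  mu B = (\sum_(i < n) mu (B `&` A i))%E.
Proof.
move=> mA tA AT mB; rewrite -measure_bigsetU_ord//.
- by rewrite -big_distrr/= bigsetU_ord_bigcup AT setIT.
- by move=> i; exact: measurableI.
- exact: trivIset_setIl.
Qed.

Lemma vec_integral_partition (d : measure_display) (S : measurableType d)
    (R : realType) (k : nat) (mu : {finite_measure set S -> \bar R})
    (n : nat) (A : 'I_n -> set S) (f : 'I_k -> S -> R) :
  (forall i, measurable (A i)) -> trivIset [set: 'I_n] A ->
  \bigcup_i A i = [set: S] -> in_L1 mu f ->
  vec_integral mu [set: S] f = \sum_(i < n) vec_integral mu (A i) f.
Proof.
move=> mA tA AT intf; apply/rowP => j; rewrite summxE mxE.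
have mf := measurable_int _ (intf j).
rewrite /Rintegral -[in LHS]AT -bigsetU_ord_bigcup integral_bigsetU_EFin//;
  last 3 first.
- exact: index_enum_uniq.
- by apply: sub_trivIset tA.
- by rewrite bigsetU_ord_bigcup AT.
(* [fine] commutes with the sum because each integral over [A i] is finite. *)
rewrite -sum_fine//; first by apply: eq_bigr => i _; rewrite mxE.
move=> i _; apply: integrable_fin_num => //.
by apply: integrableS (intf j).
Qed.

(** Cutting along the atoms encodes [nu] by finitely many ratios. The same ratios serve as
    coefficients of its moment vector, so a question about measures becomes one of linear
    algebra. *)
Lemma atomic_partition_proportional (d : measure_display) (S : measurableType d)
    (R : realType) (k : nat) (mu nu : {finite_measure set S -> \bar R})
    (n : nat) (A : 'I_n -> set S) (f : 'I_k -> S -> R) :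
  atomic_nonnull_partition mu A -> in_L1 mu f -> in_L1 nu f ->
  (forall B, measurable B -> mu B = 0%E -> nu B = 0%E) ->
  exists r : 'I_n -> {nonneg R},
    (forall B, measurable B ->
       nu B = (\sum_(i < n) ((r i)%:num%:E * mu (B `&` A i)))%E) /\
    vec_integral nu [set: S] f =
      \sum_(i < n) (r i)%:num *: vec_integral mu (A i) f.
Proof.
move=> [partA atomA] intmu intnu numu; have [mA tA AT muA_gt0] := partA.
have /choice[r rE] : forall i, exists r : {nonneg R},
    forall B, measurable B -> B `<=` A i -> nu B = (r%:num%:E * mu B)%E.
  by move=> i; exact: atom_proportional.
exists r; split=> [B mB|].
  rewrite (measure_partition _ mA tA AT mB); apply: eq_bigr => i _.
  by apply: rE => //; exact: measurableI.
rewrite (vec_integral_partition mA tA AT intnu); apply: eq_bigr => i _.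
apply/rowP => j; rewrite !mxE; apply: Rintegral_proportional (rE i) => //.
by apply: integrableS (intmu j).
Qed.

Theorem theorem7 (d : measure_display) (S : measurableType d) (R : realType)
    (Lambda : set {finite_measure set S -> \bar R})
    (k : nat) (k_ge1 : (1 <= k)%N)
    (f : 'I_k -> S -> R) (mf : forall j, measurable_fun [set: S] (f j))
    (c : 'rV[R]_k)
    (mu : {finite_measure set S -> \bar R})
    (mu_in : moment_set Lambda f c mu)
    (partition_mu : exists (m : nat) (A : 'I_m -> set S),
      [/\ (1 <= m <= k)%N,
          atomic_nonnull_partition mu A &
          free [tuple vec_integral mu (A i) f | i < m]]) :
  ex (moment_set Lambda f c) mu.
Proof.
have [_ intmu muc] := mu_in.
have [m [A [_ atomA freeA]]] := partition_mu.
split=> // t nu0 nu1 /andP[t_gt0 t_lt1] [_ int0 nu0c] [_ int1 nu1c] comb.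
(* Two nonnegative terms with zero sum both vanish, and the weights [1 - t] and [t] are nonzero. *)
have null B : measurable B -> mu B = 0%E -> nu0 B = 0%E /\ nu1 B = 0%E.
  move=> mB muB; have := comb B mB; rewrite muB.
  have t1_gt0 : 0 < 1 - t by rewrite subr_gt0.
  move/eqP; rewrite padde_eq0; last 2 first.
  - by rewrite mule_ge0// lee_fin ltW.
  - by rewrite mule_ge0// lee_fin ltW.
  rewrite !mule_eq0 !eqe (gt_eqF t1_gt0) (gt_eqF t_gt0)/=.
  by move=> /andP[/eqP -> /eqP ->].
have [|r0 [nu0E v0E]]:=
    atomic_partition_proportional (nu := nu0) atomA intmu int0.
  by move=> B mB /(null _ mB)[].
have [|r1 [nu1E v1E]]:=
    atomic_partition_proportional (nu := nu1) atomA intmu int1.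
  by move=> B mB /(null _ mB)[].
(* The differences of ratios are the coefficients of a linear relation among the independent
   vectors: its value is the difference of the two moment vectors, [c - c]. *)
have r01 i : (r0 i)%:num - (r1 i)%:num = 0.
  move/freeP : freeA => /(_ (fun i => (r0 i)%:num - (r1 i)%:num)); apply.
  transitivity (vec_integral nu0 [set: S] f - vec_integral nu1 [set: S] f).
    rewrite v0E v1E -sumrB; apply: eq_bigr => j _.
    by rewrite (nth_map j) ?size_enum_ord// nth_ord_enum scalerBl.
  by rewrite nu0c nu1c subrr.
move=> B mB; rewrite nu0E// nu1E//; apply: eq_bigr => i _.
by have /eqP := r01 i; rewrite subr_eq0 => /eqP ->.
Qed.
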